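(* Let $\pi$ be an abelian group and let $w_0:\pi\to\mathbb{F}_2$ be the trivial homomorphism. The abelianization map $\operatorname{ab}$ induces a natural $1$–$1$ correspondence between equivalence classes of abelian Gauss diagrams on $\pi$ up to R-moves (for abelian Gauss diagrams) and virtual knot types on $(\pi,w_0)$.
   Context: Classical Gauss diagrams. A classical Gauss diagram of degree $n\ge 0$ is an oriented circle with $2n$ distinct points paired by $n$ abstract oriented arrows (each from a tail to a head), each arrow carrying a sign $\pm1$ (its writhe), up to orientation-preserving homeomorphism of the circle. For $n\ge1$ its edges are the $2n$ open arcs between consecutive arrow ends; for $n=0$ the whole circle is called an edge. Two arrows cross if their endpoints alternate on the circle. For an edge $e$ bounded by ends of two different arrows: $\eta(e)=+1$ if these two arrows cross and $-1$ otherwise; $\uparrow(e)$ is the number of arrowheads at the boundary of $e$; $\varepsilon(e)=\eta(e)(-1)^{\uparrow(e)}$; $\mathrm{w}(e)$ is the product of the writhes of the two arrows. Virtual knot types on $(\pi,w_0)$ ($\pi$ abelian, written additively). A Gauss diagram on $\pi$ is a classical Gauss diagram with an element of $\pi$ on each edge (if there is no arrow, a single element of $\pi$). Removing arrows yields a subdiagram: edges that merge receive the sum of their markings. Moves: $\mathrm R_1$: add or remove (passing to the subdiagram) an arrow whose two ends bound a common edge marked $0$. $\mathrm R_2$: add or remove (passing to the subdiagram) two arrows of opposite signs such that the two heads bound a common edge and the two tails bound a common edge, both edges being marked $0$. $\mathrm R_3$: given three arrows and three edges, each pair of the arrows bounding exactly one of these edges, all three edges marked $0$, such that $\mathrm w(e)\varepsilon(e)$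 is the same for the three edges and the values $\uparrow(e)$ are pairwise different, simultaneously exchange the two arrow ends at the boundary of each of the three edges, keeping all markings. $w_0$-move: choose an arrow and $g\in\pi$; add $g$ to the marking of every edge ending at an endpoint of the arrow and subtract $g$ from the marking of every edge starting at an endpoint of the arrow (both are applied if the edge does both). A virtual knot type on $(\pi,w_0)$ is a class of Gauss diagrams on $\pi$ modulo $\mathrm R_1,\mathrm R_2,\mathrm R_3$ and $w_0$-moves. Abelian Gauss diagrams. A classical Gauss diagram $G$ is also regarded as a $1$-dimensional cell complex whose oriented $1$-cells are its edges and arrows (arrows do not intersect topologically). If $G$ has degree $n$, there are exactly $n+1$ simple loops respecting the orientations and running along at most one arrow, the fundamental loops: the base circle $K$ and, for each arrow $A$, the loop going along $A$ from tail to head and then along the circle from the head to the tail of $A$. Their classes form a basis of $H_1(G)$. An abelian Gauss diagram on $\pi$ is a classical Gauss diagram $G$ with a homomorphism $\mu:H_1(G)\to\pi$ (equivalently one element of $\pi$ for each arrow and one for $K$). The map $\operatorname{ab}$ sends a Gauss diagram on $\pi$ to the abelian Gauss diagram with the same underlying classical diagram, each fundamental loop being decorated by the sum of the markings of the edges it meets. R-moves for abelian Gauss diagrams. These are the moves having the same underlying classical shape as the moves $\mathrm R_1$ (adding or removing one arrow), $\mathrm R_2$ (adding or removing two arrows) and $\mathrm R_3$ (exchanging the ends of three arrows along three edges) for Gauss diagrams on $\pi$, where the local picture contains a unique simple unoriented loop (the obstruction loop), whose class must lie in $\ker\mu$: (i=1) add or remove an arrow whose two ends bound a common edge; obstruction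 loop: that arrow and that edge; no other condition. (i=2) add or remove two arrows of opposite signs whose heads bound a common edge and whose tails bound a common edge; obstruction loop: these two arrows and two edges. (i=3) given three arrows and three edges, each pair of arrows bounding exactly one of the edges, exchange the two arrow ends at the boundary of each edge, provided $\mathrm w(e)\varepsilon(e)$ is the same for the three edges and the $\uparrow(e)$ are pairwise different; obstruction loop: the three arrows and three edges. In all cases the decorations of the fundamental loops of the arrows present on both sides, and of $K$, are unchanged. *)

(* Defs.v *)
From HB Require Import structures.
From mathcomp Require Import all_boot all_order all_algebra all_fingroup.
From mathcomp Require Import ring zify.
From Stdlib Require Import Relation_Operators.
Set Implicit Arguments.
Unset Strict Implicit.
Unset Printing Implicit Defensive.
Import GRing.Theory.
Local Open Scope ring_scope.

(* A Gauss diagram is presented combinatorially: the marked points of the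
   oriented circle are the arrow ends (a, false) = tail and (a, true) = head,
   and [next] sends each of them to the one that follows it on the circle.
   Diagrams are considered up to orientation-preserving homeomorphism by
   including isomorphisms among the steps of both equivalences below.  *)
Record gauss_diagram := GaussDiagram {
  arrow : finType;
  next : {perm arrow * bool};
  positive : pred arrow;
  single_circle : forall x y, fconnect next x y }.

Section Classical.
Variable D : gauss_diagram.

Definition end_of : Type := (arrow D * bool)%type.

Definition tail (a : arrow D) : end_of := (a, false).
Definition head (a : arrow D) : end_of := (a, true).
Definition arrow_of (x : end_of) : arrow D := x.1.
Definition is_head (x : end_of) : bool := x.2.
Definition succ (x : end_of) : end_of := next D x.

Definition writhe (a : arrow D) : int := if positive a then 1 else -1.

(* [inl x] is the edge from x to [succ x]; [inr _] is the whole circle, which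
   is an edge exactly when there is no arrow.  *)
Definition edge : Type := (end_of + {_ : unit | #|arrow D| == 0%N})%type.

Definition edge_from (x : end_of) : edge := inl x.

(* The starting points of the edges met when running along the circle from x
   to y (none if x = y).  *)
Definition arc (x y : end_of) : seq end_of := traject succ x (findex succ x y).

Definition crossing (a b : arrow D) : bool :=
  (a != b) &&
  ((tail b \in arc (head a) (tail a)) (+) (head b \in arc (head a) (tail a))).

Section Edge.
(* x stands for the edge [edge_from x].  *)
Variable x : end_of.

Definition bdry : {set end_of} := [set x; succ x].
Definition eta : int := if crossing (arrow_of x) (arrow_of (succ x)) then 1 else -1.
Definition up : nat := #|[set y in bdry | is_head y]|.
Definition eps : int := eta * (-1) ^+ up.
Definition w : int := writhe (arrow_of x) * writhe (arrow_of (succ x)).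
End Edge.

Definition cell : Type := (edge + arrow D)%type.

Definition source (k : cell) : option end_of :=
  match k with
  | inl (inl x) => Some x
  | inl (inr _) => None
  | inr a => Some (tail a)
  end.

Definition target (k : cell) : option end_of :=
  match k with
  | inl (inl x) => Some (succ x)
  | inl (inr _) => None
  | inr a => Some (head a)
  end.

Local Notation chain := {ffun cell -> int}.

Definition boundary (c : chain) : {ffun end_of -> int} :=
  [ffun x => \sum_(k | target k == Some x) c k
             - \sum_(k | source k == Some x) c k].

Definition cycles : {pred chain} := fun c => boundary c == 0.

Lemma boundaryB (c c' : chain) : boundary (c - c') = boundary c - boundary c'.
Proof.
apply/ffunP=> x; rewrite !ffunE.
have sumB (P : pred cell) :
    \sum_(k | P k) (c - c') k = \sum_(k | P k) c k - \sum_(k | P k) c' k.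
  by rewrite -sumrB; apply: eq_bigr => k _; rewrite !ffunE.
by rewrite !sumB; ring.
Qed.

Lemma cycles_zmod_closed : zmod_closed cycles.
Proof.
split; first by rewrite unfold_in -(subrr 0) boundaryB subrr.
by move=> c c'; rewrite !unfold_in boundaryB => /eqP-> /eqP->; rewrite subrr.
Qed.

HB.instance Definition _ :=
  GRing.isZmodClosed.Build chain cycles cycles_zmod_closed.

(* There are no 2-cells, so the first homology group is the group of cycles.  *)
Record H1 : Type := Cycle { cycle_chain :> chain; _ : cycle_chain \in cycles }.
HB.instance Definition _ := [isSub for cycle_chain].
HB.instance Definition _ := [Choice of H1 by <:].
HB.instance Definition _ := [SubChoice_isSubZmodule of H1 by <:].

Lemma H1P (c : H1) : cycle_chain c \in cycles. Proof. by case: c. Qed.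

Lemma boundaryE (c : chain) (x : end_of) :
  boundary c x = c (inl (inl ((next D)^-1%g x))) - c (inl (inl x))
    + (if is_head x then c (inr (arrow_of x)) else - c (inr (arrow_of x))).
Proof.
rewrite ffunE !big_sumType /= !big_pred0_eq !addr0.
rewrite (big_pred1 ((next D)^-1%g x)) => [|y]; last first.
  by rewrite /= (inj_eq Some_inj) /succ -(inj_eq (@perm_inj _ (next D))) permKV.
rewrite (big_pred1 x) => [|y]; last by rewrite /= (inj_eq Some_inj).
have arrowS (b : bool) : \sum_(a | Some ((a, b) : end_of) == Some x) c (inr a)
    = if is_head x == b then c (inr (arrow_of x)) else 0.
  have eqE a : (Some ((a, b) : end_of) == Some x)
      = (a == arrow_of x) && (is_head x == b).
    by rewrite (inj_eq Some_inj); case: x => x1 x2; rewrite xpair_eqE [b == _]eq_sym.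
  rewrite (eq_bigl _ _ eqE); case: eqP => _; last by rewrite big_pred0 // => a; rewrite andbF.
  by rewrite (big_pred1 (arrow_of x)) // => a; rewrite andbT.
rewrite !arrowS; case: (is_head x) => /=; ring.
Qed.

Lemma mem_arc (x y z : end_of) :
  (z \in arc x y) = (findex succ x z < findex succ x y)%N.
Proof.
apply/trajectP/idP => [[i lt_i ->]|lt_z].
  by rewrite findex_iter // (ltn_trans lt_i) // findex_max // single_circle.
by exists (findex succ x z) => //; rewrite iter_findex // single_circle.
Qed.

Lemma arc_step (x y z : end_of) : x != y ->
  ((next D)^-1%g z \in arc x y)%:R - (z \in arc x y)%:R
    = (z == y)%:R - (z == x)%:R :> int.
Proof.
move=> neq_xy; rewrite !mem_arc; set u := (next D)^-1%g z.
have uE : succ u = z by rewrite /succ permKV.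
have succ_inj : injective succ by exact: perm_inj.
have lt_u := findex_max (single_circle x u : fconnect succ x u).
have lt_y := findex_max (single_circle x y : fconnect succ x y).
have := iter_findex (single_circle x u : fconnect succ x u).
set i := findex succ x u in lt_u * => iE.
have zE : iter i.+1 succ x = z by rewrite iterS iE.
have n_gt0 : (0 < findex succ x y)%N by rewrite lt0n findex_eq0.
have [zx|zNx] := eqVneq z x.
  rewrite zx findex0 n_gt0 (negPf neq_xy).
  have : (fingraph.order succ x <= i.+1)%N.
    rewrite leqNgt; apply/negP => /findex_iter; rewrite zE zx findex0 //.
  by move=> le_i; rewrite ltnNge -ltnS (leq_trans lt_y le_i).
have lt_i : (i.+1 < fingraph.order succ x)%N.
  rewrite ltn_neqAle lt_u andbT; apply/eqP => iN.
  by case/eqP: zNx; rewrite -zE iN iter_order.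
have fz : findex succ x z = i.+1 by rewrite -zE findex_iter.
have -> : (z == y) = (i.+1 == findex succ x y).
  apply/eqP/eqP => [<- //|e]; rewrite -zE e iter_findex //; exact: single_circle.
by rewrite fz; case: ltngtP (ltnS i (findex succ x y)) => [||->]; rewrite ?ltnS; lia.
Qed.

Definition arrow_chain (a : arrow D) : chain :=
  [ffun k => match k with
             | inl (inl x) => (x \in arc (head a) (tail a))%:R
             | inl (inr _) => 0
             | inr b => (b == a)%:R
             end].

Definition circle_chain : chain := [ffun k => if k is inl _ then 1 else 0].

Lemma arrow_chain_cycle (a : arrow D) : arrow_chain a \in cycles.
Proof.
apply/eqP/ffunP => x; rewrite boundaryE !ffunE arc_step; last by rewrite xpair_eqE eqxx.
have endE (b : bool) : (x == (a, b)) = (arrow_of x == a) && (is_head x == b).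
  by case: x => x1 x2; rewrite xpair_eqE.
by rewrite !endE; case: (arrow_of x == a); case: (is_head x).
Qed.

Lemma circle_chain_cycle : circle_chain \in cycles.
Proof. by apply/eqP/ffunP => x; rewrite boundaryE !ffunE; case: is_head. Qed.

Definition arrow_loop (a : arrow D) : H1 := Cycle (arrow_chain_cycle a).
Definition base_circle : H1 := Cycle circle_chain_cycle.

Lemma cycleMzE (c : H1) (m : int) (k : cell) : (c *~ m) k = c k * m.
Proof.
have -> : (c *~ m) k = (cycle_chain c *~ m) k by rewrite -[cycle_chain c]/(val c) -raddfMz.
by case: m => n; rewrite ?NegzE ?mulrNz ?mulrN ?ffunE -pmulrn ffunMnE -mulr_natr natz.
Qed.

Lemma fundamental_loops_span (c : H1) :
  exists m : int, c = \sum_a arrow_loop a *~ c (inr a) + base_circle *~ m.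
Proof.
pose d := c - \sum_a arrow_loop a *~ c (inr a).
suff [m dE] : exists m, d = base_circle *~ m.
  by exists m; rewrite -dE /d addrC subrK.
have valE k : d k = c k - \sum_a arrow_chain a k * c (inr a).
  rewrite /d; have -> : cycle_chain = val by [].
  rewrite raddfB raddf_sum !ffunE; congr (_ - _).
  rewrite sum_ffunE; apply: eq_bigr => a _; exact: cycleMzE.
have d_arrow a : d (inr a) = 0.
  rewrite valE (bigD1 a) //= big1 ?ffunE ?eqxx ?mul1r ?addr0 ?subrr //.
  by move=> b ba; rewrite ffunE eq_sym (negPf ba) mul0r.
have d_edge x : d (inl (inl (succ x))) = d (inl (inl x)).
  have /eqP/ffunP/(_ (succ x)) := H1P d.
  rewrite boundaryE !d_arrow oppr0 if_same addr0 permK [X in _ = X]ffunE.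
  by move/subr0_eq.
have [m dm] : exists m, forall e : edge, d (inl e) = m.
  have [x0 _|no_end] := pickP (predT : pred end_of).
    exists (d (inl (inl x0))) => -[x|[u no_arrow]].
      rewrite -(iter_findex (single_circle x0 x : fconnect succ x0 x)).
      by elim: (findex _ _ _) => //= n IHn; rewrite d_edge.
    by have := card0_eq (eqP no_arrow) (arrow_of x0).
  have [u _|no_circle] := pickP (predT : pred {u : unit | #|arrow D| == 0%N}).
    exists (d (inl (inr u))) => -[x|v]; first by have := no_end x.
    by congr (cycle_chain d (inl (inr _))); apply: val_inj; case: (val u) (val v) => [] [].
  by exists 0 => -[x|v]; [have := no_end x | have := no_circle v].
exists m; apply/val_inj/ffunP => k.
rewrite -[LHS]/(d k) [RHS]cycleMzE [X in _ = X * _]ffunE.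
by case: k => [e|a]; rewrite ?dm ?d_arrow ?mul0r ?mul1r.
Qed.

End Classical.

Definition map_end (D D' : gauss_diagram) (f : arrow D -> arrow D')
  (x : end_of D) : end_of D' := (f (arrow_of x), is_head x).

Definition isomorphism (D D' : gauss_diagram) (f : arrow D -> arrow D') : Prop :=
  [/\ bijective f, forall a, positive (f a) = positive a
    & forall x, map_end f (succ x) = succ (map_end f x)].

(* [f] identifies D' with the subdiagram of D whose arrows are the values of
   [f]: no end of such an arrow is strictly between the images of two
   consecutive ends of D'.  *)
Definition subdiagram (D D' : gauss_diagram) (f : arrow D' -> arrow D) : Prop :=
  [/\ injective f, forall a, positive (f a) = positive a
    & forall x y, y \in behead (arc (map_end f x) (map_end f (succ x))) ->
        arrow_of y \notin codom f].

(* The edges involved in the moves have end points, so they are given by the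
   end at which they start.  In all the shapes of the moves, [f] compares the
   arrows present on both sides.  *)
Section Shapes.
Variables D D' : gauss_diagram.

Definition R1_shape (f : arrow D' -> arrow D) (a : arrow D) (x : end_of D) : Prop :=
  [/\ subdiagram f, forall c, (c \in codom f) = (c != a)
    & bdry x = [set head a; tail a]].

Definition R2_shape (f : arrow D' -> arrow D) (a b : arrow D) (x y : end_of D) : Prop :=
  [/\ subdiagram f, forall c, (c \in codom f) = (c != a) && (c != b),
      positive a != positive b,
      bdry x = [set head a; head b]
    & bdry y = [set tail a; tail b]].

Definition exchange (x : 'I_3 -> end_of D) : {perm end_of D} :=
  (\prod_(i < 3) tperm (x i) (succ (x i)))%g.

(* The three edges are disjoint closed arcs, so that the ends at their
   boundaries can be exchanged simultaneously.  After the exchange, the point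
   of the circle occupied by y is occupied by [exchange x y].  *)
Definition R3_shape (f : arrow D -> arrow D') (a : 'I_3 -> arrow D)
    (x : 'I_3 -> end_of D) : Prop :=
  [/\ [/\ injective a,
        forall i j, i != j ->
          exists! k, [set arrow_of y | y in bdry (x k)] = [set a i; a j]
        & forall i j, i != j -> [disjoint bdry (x i) & bdry (x j)]],
      forall i j, w (x i) * eps (x i) = w (x j) * eps (x j),
      forall i j, i != j -> up (x i) != up (x j)
    & [/\ bijective f, forall c, positive (f c) = positive c
        & forall y, succ (map_end f (exchange x y))
                    = map_end f (exchange x (succ y))]].
End Shapes.

Section Markings.
Variable pi : zmodType.

Record marked_diagram := Marked {
  marked_shape :> gauss_diagram;
  mark : edge marked_shape -> pi }.

(* The edges that merge receive the sum of their markings.  *)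
Definition merged_marking (D D' : marked_diagram) (f : arrow D' -> arrow D) : Prop :=
  (forall x, mark (edge_from x) =
     \sum_(y <- arc (map_end f x) (map_end f (succ x))) mark (edge_from y))
  /\ (forall u, mark (inr u : edge D') = \sum_(e : edge D) mark e).

Definition marked_iso (D D' : marked_diagram) : Prop :=
  exists f : arrow D -> arrow D',
    [/\ isomorphism f,
        forall x, mark (edge_from (map_end f x)) = mark (edge_from x)
      & forall u v, mark (inr u : edge D') = mark (inr v : edge D)].

Definition marked_R1 (D D' : marked_diagram) : Prop :=
  exists (f : arrow D' -> arrow D) (a : arrow D) (x : end_of D),
    [/\ R1_shape f a x, merged_marking f & mark (edge_from x) = 0].

Definition marked_R2 (D D' : marked_diagram) : Prop :=
  exists (f : arrow D' -> arrow D) (a b : arrow D) (x y : end_of D),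
    [/\ R2_shape f a b x y, merged_marking f, mark (edge_from x) = 0
      & mark (edge_from y) = 0].

Definition marked_R3 (D D' : marked_diagram) : Prop :=
  exists (f : arrow D -> arrow D') (a : 'I_3 -> arrow D) (x : 'I_3 -> end_of D),
    [/\ R3_shape f a x, forall i, mark (edge_from (x i)) = 0
      & forall y, mark (edge_from (map_end f (exchange x y))) = mark (edge_from y)].

Definition w0_move (D : marked_diagram) (a : arrow D) (g : pi) : marked_diagram :=
  @Marked D (fun e => match e with
    | inl x => mark e + g *+ (arrow_of (succ x) == a) - g *+ (arrow_of x == a)
    | inr _ => mark e
    end).

Definition virtual_step (D D' : marked_diagram) : Prop :=
  marked_iso D D' \/ marked_R1 D D' \/ marked_R2 D D' \/ marked_R3 D D'
  \/ exists (a : arrow D) (g : pi), D' = w0_move a g.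

Record abelian_diagram := Abelian {
  abelian_shape :> gauss_diagram;
  mu : {additive H1 abelian_shape -> pi} }.

(* By [fundamental_loops_span], [mu] is determined by these values.  *)
Definition same_decorations (A A' : abelian_diagram) (f : arrow A -> arrow A') : Prop :=
  (forall a, mu A' (arrow_loop (f a)) = mu A (arrow_loop a))
  /\ mu A' (base_circle A') = mu A (base_circle A).

(* In the three cases below, the cells in S form a single unoriented simple
   loop, of which such a c is the class up to sign.  *)
Definition obstruction_vanishes (A : abelian_diagram) (S : {set cell A}) : Prop :=
  exists2 c : H1 A, (forall k, `|c k| = (k \in S)%:R) & mu A c = 0.

Definition edge_cell (D : gauss_diagram) (x : end_of D) : cell D := inl (edge_from x).
Definition arrow_cell (D : gauss_diagram) (a : arrow D) : cell D := inr a.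

Definition abelian_iso (A A' : abelian_diagram) : Prop :=
  exists f : arrow A -> arrow A', isomorphism f /\ same_decorations f.

Definition abelian_R1 (A A' : abelian_diagram) : Prop :=
  exists (f : arrow A' -> arrow A) (a : arrow A) (x : end_of A),
    [/\ R1_shape f a x, same_decorations f
      & obstruction_vanishes [set arrow_cell a; edge_cell x]].

Definition abelian_R2 (A A' : abelian_diagram) : Prop :=
  exists (f : arrow A' -> arrow A) (a b : arrow A) (x y : end_of A),
    [/\ R2_shape f a b x y, same_decorations f
      & obstruction_vanishes
          [set arrow_cell a; arrow_cell b; edge_cell x; edge_cell y]].

Definition abelian_R3 (A A' : abelian_diagram) : Prop :=
  exists (f : arrow A -> arrow A') (a : 'I_3 -> arrow A) (x : 'I_3 -> end_of A),
    [/\ R3_shape f a x, same_decorations f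
      & obstruction_vanishes
          ([set arrow_cell (a i) | i : 'I_3] :|: [set edge_cell (x i) | i : 'I_3])].

Definition abelian_step (A A' : abelian_diagram) : Prop :=
  abelian_iso A A' \/ abelian_R1 A A' \/ abelian_R2 A A' \/ abelian_R3 A A'.

Section Abelianization.
Variable D : marked_diagram.

Definition ab_mu (c : H1 D) : pi := \sum_(e : edge D) mark e *~ c (inl e).

Lemma ab_mu_zmod_morphism : zmod_morphism ab_mu.
Proof.
move=> c c'; rewrite /ab_mu -sumrB; apply: eq_bigr => e _.
by rewrite -mulrzBr; congr (_ *~ _); rewrite !ffunE.
Qed.

HB.instance Definition _ := GRing.isZmodMorphism.Build (H1 D) pi ab_mu ab_mu_zmod_morphism.

Definition ab : abelian_diagram := @Abelian D ab_mu.

Lemma ab_arrow_loop (a : arrow D) :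
  mu ab (arrow_loop a) = \sum_(x <- arc (head a) (tail a)) mark (edge_from x).
Proof.
have arc_uniq : uniq (arc (head a) (tail a)).
  have /ltnW le_n := findex_max (single_circle (head a) (tail a)
    : fconnect (@succ D) (head a) (tail a)).
  by rewrite /arc -(take_traject (@succ D) (head a) le_n) take_uniq // orbit_uniq.
rewrite big_uniq //= /ab_mu big_sumType /= [X in _ + X]big1 ?addr0 => [|u _]; last first.
  by rewrite ffunE mulr0z.
rewrite [RHS]big_mkcond; apply: eq_bigr => x _; rewrite ffunE.
by case: (x \in _).
Qed.

Lemma ab_base_circle : mu ab (base_circle D) = \sum_(e : edge D) mark e.
Proof. by apply: eq_bigr => e _; rewrite ffunE. Qed.
End Abelianization.
End Markings.

(* The set of classes of the equivalence relation generated by [step], a class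
   being identified with its membership predicate.  *)
Definition classes (T : Type) (step : T -> T -> Prop) : Type :=
  {C : T -> Prop | exists x, C = clos_refl_sym_trans T step x}.

Definition class_of (T : Type) (step : T -> T -> Prop) (x : T) : classes step :=
  exist _ (clos_refl_sym_trans T step x) (ex_intro _ x erefl).

Definition virtual_knot_type (pi : zmodType) : Type := classes (@virtual_step pi).
Definition abelian_class (pi : zmodType) : Type := classes (@abelian_step pi).

(* Main.v *)
Require Import Defs.
From mathcomp Require Import all_boot all_order all_algebra.
From mathcomp Require Import fingroup perm ring.
From Stdlib Require Import Relation_Operators.
From Stdlib Require Import FunctionalExtensionality PropExtensionality ProofIrrelevance.
(* After the import of [path], whose [arc] would otherwise be meant. *)
Import Defs.
Set Implicit Arguments.
Unset Strict Implicit.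
Unset Printing Implicit Defensive.
Import GRing.Theory Num.Theory.
Local Open Scope ring_scope.

(** The loop of an arrow is decorated by the sum of the marks along the arc
    from its head to its tail, so adding a coboundary [P (succ x) - P x] with
    [P] constant on arrows, i.e. a product of [w0]-moves, does not affect the
    decorations. Conversely every abelian diagram has a
    marking inducing it, and two such markings differ by a function with zero
    sum on the circle, hence by a coboundary [P (succ x) - P x], where the loop
    of each arrow forces [P] to agree at its two ends. It remains to match the
    moves: an R-move of marked diagrams preserves the arc sums and its
    obstruction loop is a sum of zero marks; given an abelian move, [w0]-moves
    at arrows of the loop kill the marks of all its edges but one, and the
    vanishing of the obstruction kills the last one. *)

(** * Arcs of the circle *)

Section Arcs.
Variable D : gauss_diagram.
Implicit Types x y z : end_of D.

Lemma succ_inj : injective (@succ D).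
Proof. exact: perm_inj. Qed.

Lemma order_succ x y : fingraph.order (@succ D) x = fingraph.order (@succ D) y.
Proof. by apply: eq_card => z; rewrite !inE !(single_circle _ _ : fconnect (@succ D) _ _). Qed.

Lemma succ_neq x : succ x != x.
Proof.
(* A fixed point would be alone on the circle, which also carries the other end of its arrow. *)
apply/eqP => e; have /iter_findex := single_circle x (arrow_of x, ~~ is_head x).
have -> n : iter n (next D) x = x by elim: n => //= n ->; exact: e.
by case: x {e} => a [].
Qed.

Lemma findex_iter_lt k x y :
  (k < fingraph.order (@succ D) x)%N -> iter k (@succ D) x = y -> findex (@succ D) x y = k.
Proof. by move=> lt_k <-; exact: findex_iter. Qed.

(** Arcs exclude their last point, so the hypothesis says that a run from [x] meets [y] no later
    than [v]. *)
Lemma arc_cat x y v : v \notin arc x y -> arc x v = arc x y ++ arc y v.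
Proof.
rewrite mem_arc -leqNgt => le_yv.
have ey := iter_findex (single_circle x y : fconnect (@succ D) x y).
have ev := iter_findex (single_circle x v : fconnect (@succ D) x v).
have lt_v := findex_max (single_circle x v : fconnect (@succ D) x v).
rewrite /arc (@findex_iter_lt (findex (@succ D) x v - findex (@succ D) x y) y v).
- by rewrite -[X in traject _ x X](subnKC le_yv) trajectD ey.
- by rewrite (order_succ y x) (leq_ltn_trans _ lt_v) ?leq_subr.
- by rewrite -{2}ey -iterD subnK.
Qed.

Lemma arc_refl x : arc x x = [::].
Proof. by rewrite /arc findex0. Qed.

Lemma arc_succ x : arc x (succ x) = [:: x].
Proof.
suff e : findex (@succ D) x (succ x) = 1%N by rewrite /arc e.
apply: findex_iter_lt => //; rewrite ltnNge; apply/negP => le1.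
have n1 : fingraph.order (@succ D) x = 1%N by apply/eqP; rewrite eqn_leq le1 fingraph.order_gt0.
by have /eqP := iter_order succ_inj x; rewrite n1 /= (negPf (succ_neq x)).
Qed.

Lemma arc_cons x y : x != y -> arc x y = x :: arc (succ x) y.
Proof. by move=> neq; rewrite (@arc_cat x (succ x)) arc_succ // inE eq_sym. Qed.

(** The starting point advances towards a fixed [y], and each step shortens the arc. *)
Lemma arc_ind (P : end_of D -> end_of D -> Prop) :
  (forall x, P x x) -> (forall x y, x != y -> P (succ x) y -> P x y) ->
  forall x y, P x y.
Proof.
move=> P0 P1 x y; have [n] := ubnP (size (arc x y)).
elim: n x => // n IHn x lt_n; have [->//|neq] := eqVneq x y.
by apply: P1 => //; apply: IHn; move: lt_n; rewrite arc_cons.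
Qed.

Lemma findex_sum x y : x != y ->
  (findex (@succ D) x y + findex (@succ D) y x = fingraph.order (@succ D) x)%N.
Proof.
move=> neq; have lt := findex_max (single_circle x y : fconnect (@succ D) x y).
have n_gt0 : (0 < findex (@succ D) x y)%N by rewrite lt0n findex_eq0.
rewrite (@findex_iter_lt (fingraph.order (@succ D) x - findex (@succ D) x y) y x).
- by rewrite subnKC // ltnW.
- by rewrite (order_succ y x) ltn_subrL n_gt0 fingraph.order_gt0.
- have := iter_findex (single_circle x y : fconnect (@succ D) x y).
  move: lt; set i := findex _ x y; set n := fingraph.order _ _ => lt <-.
  rewrite -iterD subnK; last exact: ltnW.
  exact: (iter_order (@succ_inj) x).
Qed.

(** The two arcs concatenate to one turn of the orbit of [x]. Distinct end points matter: [arc x x]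
    is empty rather than a full turn. *)
Lemma circle_perm x y : x != y -> perm_eq (arc x y ++ arc y x) (index_enum (end_of D)).
Proof.
move=> neq; have e : arc x y ++ arc y x = orbit (@succ D) x.
  rewrite /orbit -(findex_sum neq) trajectD /arc.
  by rewrite (iter_findex (single_circle x y : fconnect (@succ D) x y)).
rewrite e; apply: uniq_perm; [exact: orbit_uniq|exact: index_enum_uniq|].
by move=> z; rewrite mem_index_enum -fconnect_orbit; exact: single_circle.
Qed.

End Arcs.

(** * Sums along arcs and potentials on the circle *)

Section ArcSums.
Variables (pi : zmodType) (D : gauss_diagram).
Implicit Types (x y z v : end_of D) (F P : end_of D -> pi).

Definition arc_sum F x y : pi := \sum_(z <- arc x y) F z.

Lemma arc_sum_cat F x y v : v \notin arc x y ->
  arc_sum F x v = arc_sum F x y + arc_sum F y v.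
Proof. by move=> vN; rewrite /arc_sum (arc_cat vN) big_cat. Qed.

Lemma arc_sum_refl F x : arc_sum F x x = 0.
Proof. by rewrite /arc_sum arc_refl big_nil. Qed.

Lemma arc_sum_cons F x y : x != y -> arc_sum F x y = F x + arc_sum F (succ x) y.
Proof. by move=> neq; rewrite /arc_sum (arc_cons neq) big_cons. Qed.

Lemma arc_sum_succ F x : arc_sum F x (succ x) = F x.
Proof. by rewrite /arc_sum arc_succ big_seq1. Qed.

Lemma arc_sum_telescope P x y : arc_sum (fun z => P (succ z) - P z) x y = P y - P x.
Proof.
move: x y; apply: arc_ind => [x|x y neq IHx]; first by rewrite arc_sum_refl subrr.
by rewrite arc_sum_cons // IHx addrC addrA subrK.
Qed.

Lemma arc_sumC F x y : x != y -> arc_sum F x y + arc_sum F y x = \sum_z F z.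
Proof. by move=> neq; rewrite /arc_sum -big_cat; exact: perm_big (circle_perm neq). Qed.

Lemma sum_telescope P : \sum_z (P (succ z) - P z) = 0.
Proof.
rewrite sumrB [X in _ - X](reindex_inj (@succ_inj D)) subrr //.
Qed.

(** A primitive is minus the sum of [F] from [z] to a base point [x0]. The zero total is what makes
    it consistent across [x0], where the arc jumps from empty to a full turn less one edge. *)
Lemma potential_of_sum0 F : \sum_z F z = 0 -> exists P, forall x, F x = P (succ x) - P x.
Proof.
move=> F0; have [x0 _|no_end] := pickP (predT : pred (end_of D)); last first.
  by exists (fun=> 0) => x; have := no_end x.
exists (fun z => - arc_sum F z x0) => x; rewrite opprK addrC.
have [->|neq] := eqVneq x x0; last by rewrite arc_sum_cons // addrK.
apply/eqP; rewrite -subr_eq0 arc_sum_refl sub0r opprK -F0.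
by rewrite -(@arc_sumC F x0 (succ x0)) ?arc_sum_succ // eq_sym succ_neq.
Qed.

(** The end [x] witnesses that there is an arrow, so that the whole circle is not an edge. *)
Lemma sum_edges x (m : edge D -> pi) : \sum_e m e = \sum_z m (edge_from z).
Proof.
rewrite big_sumType /= [X in _ + X]big1 ?addr0 // => -[u n0].
by have := fintype0 (arrow_of x) (eqP n0).
Qed.

Lemma no_end_circle x (u : {_ : unit | #|arrow D| == 0%N}) : False.
Proof. by have := fintype0 (arrow_of x) (eqP (valP u)). Qed.

Lemma sum_edges0 u (m : edge D -> pi) : \sum_e m e = m (inr u).
Proof.
rewrite big_sumType /= big1 ?add0r => [|x _]; last by have := no_end_circle x u.
rewrite (big_pred1 u) // => v; apply/esym/eqP/val_inj.
Qed.

End ArcSums.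

Notation "x ~v y" := (clos_refl_sym_trans _ (@virtual_step _) x y) (at level 70).
Notation "x ~a y" := (clos_refl_sym_trans _ (@abelian_step _) x y) (at level 70).

(** * Markings and their loop decorations *)

Section Potentials.
Variables (pi : zmodType) (D : gauss_diagram).

(** The joint effect of one [w0]-move at each arrow [a], with group element [p a]. *)
Definition add_potential (p : arrow D -> pi) (m : edge D -> pi) (e : edge D) : pi :=
  match e with
  | inl x => m e + p (arrow_of (succ x)) - p (arrow_of x)
  | inr _ => m e
  end.

Lemma add_potential_virtual p m : Marked m ~v Marked (add_potential p m).
Proof.
(* [q s] is the potential accumulated by the [w0]-moves at the arrows listed in [s], performed one
   by one. *)
pose q s a := \sum_(b <- s) p b *+ (a == b).
have -> : add_potential p m = add_potential (q (enum (arrow D))) m.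
  have qE a : q (enum (arrow D)) a = p a.
    rewrite /q big_enum /= (bigD1 a) //= eqxx big1 ?addr0 // => b /negPf.
    by rewrite eq_sym => ->.
  by apply: functional_extensionality => -[x|u] //=; rewrite !qE.
elim: (enum _) => [|a s IHs].
  have -> : add_potential (q [::]) m = m.
    by apply: functional_extensionality => -[x|u] //=; rewrite /q !big_nil addr0 subr0.
  exact: rst_refl.
apply: rst_trans IHs _; apply: rst_step; do 4! right.
exists a, (p a); congr Marked; apply: functional_extensionality => -[x|u] //=.
by rewrite /q !big_cons opprD !addrA [RHS](ACl (1*4*2*5*3)).
Qed.

(** The added terms telescope to a difference of values of [p] at the same arrow. *)
Lemma arc_sum_add_potential p m x y : arrow_of x = arrow_of y ->
  arc_sum (fun z => add_potential p m (edge_from z)) x y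
    = arc_sum (fun z => m (edge_from z)) x y.
Proof.
move=> exy; have := arc_sum_telescope (fun z => p (arrow_of z)) x y.
rewrite exy subrr /arc_sum /= => e0.
by rewrite -[RHS]addr0 -[X in _ + X]e0 -big_split; apply: eq_bigr => z _; rewrite /= addrA.
Qed.

Lemma sum_add_potential p m : \sum_e add_potential p m e = \sum_e m e.
Proof.
rewrite !big_sumType /=; congr (_ + _).
have := sum_telescope (fun z => p (arrow_of z)) => e0.
by rewrite -[RHS]addr0 -[X in _ + X]e0 -big_split; apply: eq_bigr => z _; rewrite /= addrA.
Qed.

End Potentials.

Section Lifts.
Variables (pi : zmodType) (A : abelian_diagram pi).

Definition is_lift (m : edge A -> pi) : Prop :=
  (forall a, arc_sum (fun z => m (edge_from z)) (head a) (tail a) = mu A (arrow_loop a))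
  /\ \sum_e m e = mu A (base_circle A).

Lemma lift_exists : exists m, is_lift m.
Proof.
pose K := mu A (base_circle A).
have [x0 _|no_end] := pickP (predT : pred (end_of A)); last first.
  exists (fun=> K); split=> [a|]; first by have := no_end (head a).
  have no_arrow : #|arrow A| == 0%N by apply/eqP/eq_card0 => a; exact: (no_end (head a)).
  exact: (sum_edges0 (exist _ tt no_arrow)).
(* A coboundary, corrected by putting the decoration of the circle on the
   edge from x0 in order to reach the required total. *)
pose jump x : pi := K *+ (x == x0).
(* With [P] zero at heads, its value at a tail is the telescoped sum from the head: the prescribed
   decoration less the contribution of [jump]. *)
pose P x := if is_head x then 0
  else mu A (arrow_loop (arrow_of x)) - arc_sum jump (head (arrow_of x)) x.
exists (fun e => if e is inl x then P (succ x) - P x + jump x else K); split=> [a|].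
  rewrite /arc_sum big_split /= -/(arc_sum _ _ _) -/(arc_sum _ _ _).
  by rewrite arc_sum_telescope /P /= subr0 subrK.
rewrite (sum_edges x0) big_split /= sum_telescope add0r (bigD1 x0) //= big1.
  by rewrite /jump eqxx addr0.
by move=> x /negPf; rewrite /jump => ->.
Qed.

Lemma lift_unique m m' : is_lift m -> is_lift m' -> Marked m ~v Marked m'.
Proof.
move=> [m_a m_K] [m'_a m'_K].
have d_K : \sum_z (m' (edge_from z) - m (edge_from z)) = 0.
  have [x0 _|no_end] := pickP (predT : pred (end_of A)).
    by rewrite sumrB -!(sum_edges x0) m_K m'_K subrr.
  by apply: big1 => x; have := no_end x.
have [P dP] := potential_of_sum0 d_K.
(* The sums of both markings from head to tail are the decoration of [a], so the difference
   telescopes to zero there. *)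
have PE a : P (tail a) = P (head a).
  apply/eqP; rewrite -subr_eq0 -arc_sum_telescope /arc_sum.
  under eq_bigr => z _ do rewrite -dP.
  by rewrite sumrB -/(arc_sum _ _ _) -/(arc_sum _ _ _) m_a m'_a subrr.
suff -> : m' = add_potential (fun a => P (head a)) m by exact: add_potential_virtual.
have hE x : P (head (arrow_of x)) = P x by case: x => a [] /=; rewrite -?PE.
apply: functional_extensionality => -[x|u] /=.
  by rewrite !hE -addrA -dP addrC subrK.
by rewrite -!(sum_edges0 u) m_K m'_K.
Qed.

End Lifts.

(** * Transport of arc sums along maps of arrow ends *)

Section Transport.
Variables (pi : zmodType) (D D' : gauss_diagram) (phi : end_of D -> end_of D').
Variables (F : end_of D -> pi) (F' : end_of D' -> pi).
Hypothesis phi_inj : injective phi.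
Hypothesis phi_between : forall x z, phi z \notin behead (arc (phi x) (phi (succ x))).
Hypothesis phi_sum : forall x, F x = arc_sum F' (phi x) (phi (succ x)).

(** The arcs over successive edges concatenate without overlap, because no image of an end lies
    strictly inside one of them. This serves subdiagrams and, with another [phi], R3. *)
Lemma arc_sum_map x y : arc_sum F x y = arc_sum F' (phi x) (phi y).
Proof.
move: x y; apply: arc_ind => [x|x y neq IHx]; first by rewrite !arc_sum_refl.
rewrite arc_sum_cons // IHx phi_sum -arc_sum_cat //.
have neq' : phi x != phi (succ x) by rewrite (inj_eq phi_inj) eq_sym succ_neq.
(* To concatenate, [phi y] must avoid the first arc: its first point by injectivity, the others by
   [phi_between]. *)
have := phi_between x y; rewrite (arc_cons neq') inE negb_or /= => ->.
by rewrite andbT (inj_eq phi_inj) eq_sym.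
Qed.

(** Cutting at [x] and [succ x] splits the two circles into corresponding pairs of arcs. *)
Lemma sum_map (x : end_of D) : \sum_z F z = \sum_z F' z.
Proof.
have neq : x != succ x by rewrite eq_sym succ_neq.
rewrite -(arc_sumC F neq) !arc_sum_map; apply: arc_sumC.
by rewrite (inj_eq phi_inj).
Qed.

End Transport.

Lemma map_end_inj (D D' : gauss_diagram) (f : arrow D -> arrow D') :
  injective f -> injective (map_end f).
Proof. by move=> f_inj [a b] [a' b'] [/f_inj -> ->]. Qed.

Lemma isomorphism_subdiagram (D D' : gauss_diagram) (f : arrow D -> arrow D') :
  isomorphism f -> subdiagram f.
Proof.
by case=> f_bij f_pos f_succ; split=> [|//|x y]; [exact: bij_inj|rewrite f_succ arc_succ].
Qed.

Section Decorations.
Variable pi : zmodType.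
Implicit Types (D : marked_diagram pi) (A : abelian_diagram pi).

Definition edge_mark D (x : end_of D) : pi := mark (edge_from x).

Lemma same_decorations_ab D D' (f : arrow D -> arrow D') :
  (forall a, arc_sum (@edge_mark D') (head (f a)) (tail (f a))
     = arc_sum (@edge_mark D) (head a) (tail a)) ->
  \sum_(e : edge D') mark e = \sum_(e : edge D) mark e ->
  same_decorations (A := ab D) (A' := ab D') f.
Proof. by move=> fa fK; split=> [a|]; rewrite ?ab_arrow_loop ?ab_base_circle //; exact: fa. Qed.

Lemma ab_is_lift D : is_lift (A := ab D) (@mark _ D).
Proof. by split=> [a|]; rewrite ?ab_arrow_loop ?ab_base_circle. Qed.

Lemma merged_same_decorations D D' (f : arrow D' -> arrow D) :
  subdiagram f -> merged_marking f -> same_decorations (A := ab D') (A' := ab D) f.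
Proof.
case=> f_inj _ f_between [f_mark f_circle].
have phi_inj := map_end_inj f_inj.
have phi_between x z : map_end f z \notin behead (arc (map_end f x) (map_end f (succ x))).
  by apply/negP => /f_between; rewrite /map_end /= codom_f.
apply: same_decorations_ab => [a|].
  by symmetry; exact: (arc_sum_map phi_inj phi_between f_mark).
have [x _|no_end] := pickP (predT : pred (end_of D')).
  by rewrite (sum_edges x) (sum_edges (map_end f x)); symmetry;
    exact: (sum_map phi_inj phi_between f_mark x).
(* Without arrows in [D'], its only edge is the whole circle, which received the total of [D]. *)
have no_arrow : #|arrow D'| == 0%N by apply/eqP/eq_card0 => a; exact: (no_end (head a)).
by rewrite (sum_edges0 (exist _ tt no_arrow)) f_circle.
Qed.

(** The decorations prescribed by [A'] and those induced by [m'] are both read off through [f] in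
    [A], where [m] makes them agree. *)
Lemma lift_pull A A' (f : arrow A' -> arrow A) m m' :
  is_lift (A := A) m -> same_decorations f ->
  same_decorations (A := ab (Marked m')) (A' := ab (Marked m)) f -> is_lift (A := A') m'.
Proof.
case=> m_a m_K [f_a f_K] [g_a g_K]; split=> [a|].
  by rewrite -f_a -m_a; have := g_a a; rewrite !ab_arrow_loop => /esym.
by rewrite -f_K -m_K; move: g_K; rewrite !ab_base_circle => /esym.
Qed.

(** In this direction [f] must reach every arrow of [A'], since a lift has to account for all their
    loops. *)
Lemma lift_push A A' (f : arrow A -> arrow A') m m' : bijective f ->
  is_lift (A := A) m -> same_decorations f ->
  same_decorations (A := ab (Marked m)) (A' := ab (Marked m')) f -> is_lift (A := A') m'.
Proof.
case=> g fK gK [m_a m_K] [f_a f_K] [g_a g_K]; split=> [a|].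
  by rewrite -(gK a) f_a -m_a; have := g_a (g a); rewrite !ab_arrow_loop.
by rewrite f_K -m_K; move: g_K; rewrite !ab_base_circle.
Qed.

(** Two homomorphisms that agree on the fundamental loops agree on [H1], which these loops span. *)
Lemma lift_mu A m : is_lift (A := A) m -> forall c, mu A c = mu (ab (Marked m)) c.
Proof.
case=> m_a m_K c; have [k ->] := fundamental_loops_span c.
rewrite !raddfD !raddf_sum !raddfMz -m_K -(ab_base_circle (Marked m)).
congr (_ + _); apply: eq_bigr => a _.
by rewrite !raddfMz -m_a; congr (_ *~ _); rewrite ab_arrow_loop.
Qed.

(** The two values of [mu] agree on every class, so the identity is an isomorphism step; the
    diagrams need not be equal terms. *)
Lemma lift_ab A m : is_lift (A := A) m -> A ~a ab (Marked m).
Proof.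
move=> m_lift; apply: rst_step; left; exists id; split.
  split=> //; first by exists id.
  by move=> x; rewrite /map_end /arrow_of /is_head -!surjective_pairing.
by split=> [a|]; symmetry; exact: lift_mu.
Qed.

Lemma is_lift_add_potential A m p :
  is_lift (A := A) m -> is_lift (A := A) (add_potential p m).
Proof. by case=> m_a m_K; split=> [a|]; rewrite ?arc_sum_add_potential ?sum_add_potential. Qed.

(** [ab_mu] ignores arrows, so the class of the loop is a signed sum of the marks of its edges, all
    zero. *)
Lemma obstruction_vanishes_ab D (S : {set cell D}) (c : H1 D) :
  (forall k, `|c k| = (k \in S)%:R) ->
  (forall x, edge_cell x \in S -> mark (edge_from x) = 0) ->
  (forall u, inl (inr u) \notin S) ->
  obstruction_vanishes (A := ab D) S.
Proof.
move=> cS S0 S1; exists c => //=; apply: big1 => -[x|u] _.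
  have [/S0 ->|xS] := boolP (edge_cell x \in S); first by rewrite mul0rz.
  have /eqP := cS (edge_cell x); rewrite (negPf xS) normr_eq0 => /eqP ->.
  by rewrite mulr0z.
have /eqP := cS (inl (inr u)); rewrite (negPf (S1 u)) normr_eq0 => /eqP ->.
by rewrite mulr0z.
Qed.

(** With every other edge of the loop marked zero, the class of the loop is sent to plus or minus
    the mark of [x]. *)
Lemma obstruction_mark A m (S : {set cell A}) x :
  is_lift m -> obstruction_vanishes S -> edge_cell x \in S ->
  (forall e, e != edge_from x -> inl e \in S -> m e = 0) -> m (edge_from x) = 0.
Proof.
move=> m_lift [c cS]; rewrite (lift_mu m_lift) /= /ab_mu (bigD1 (edge_from x)) //=.
move=> c0 xS S0; move: c0; rewrite big1 ?addr0 => [|e ex]; last first.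
  have [/(S0 _ ex) ->|eS] := boolP (inl e \in S); first by rewrite mul0rz.
  by have /eqP := cS (inl e); rewrite (negPf eS) normr_eq0 => /eqP ->; rewrite mulr0z.
have := cS (edge_cell x); rewrite xS /edge_cell.
have [_ ->|_ e] := ger0P (c (inl (edge_from x))); first by rewrite mulr1z.
by rewrite -[cycle_chain c _]opprK e mulrNz mulr1z => /eqP; rewrite oppr_eq0 => /eqP.
Qed.

End Decorations.
(** * Obstruction loops *)

Section PathChains.
Variable D : gauss_diagram.
Local Notation chain := {ffun cell D -> int}.
Implicit Types (S T : {set cell D}) (u v z : end_of D).

(* The cells of [S] form a path from [u] to [v], up to orientation and closed
   components. *)
Definition path_chain S u v : Prop :=
  exists2 c : chain, (forall k, `|c k| = (k \in S)%:R)
    & forall z, boundary c z = (z == v)%:R - (z == u)%:R.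

Lemma path_chain_sym S u v : path_chain S u v -> path_chain S v u.
Proof.
case=> c cS bc; exists (- c) => [k|z]; first by rewrite ffunE normrN.
have -> : boundary (- c) z = - boundary c z by rewrite !boundaryE !ffunE; case: ifP => _; ring.
by rewrite bc opprB.
Qed.

(** Disjointness keeps the coefficients of the sum of absolute value at most one, and the boundary
    terms at [v] cancel. *)
Lemma path_chain_cat S T u v z : [disjoint S & T] ->
  path_chain S u v -> path_chain T v z -> path_chain (S :|: T) u z.
Proof.
move=> dis [c cS bc] [d dT bd]; exists (c + d) => [k|y].
  rewrite ffunE inE; have := cS k; have := dT k.
  have [kS|kS] := boolP (k \in S).
    rewrite (disjointFr dis kS) => /eqP; rewrite normr_eq0 => /eqP -> <-.
    by rewrite addr0.
  by move=> <- /eqP; rewrite normr_eq0 => /eqP ->; rewrite add0r.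
have -> : boundary (c + d) y = boundary c y + boundary d y.
  by rewrite !boundaryE !ffunE; case: ifP => _; ring.
by rewrite bc bd addrC addrA subrK.
Qed.

Lemma path_chain_loop S u : path_chain S u u ->
  exists c : H1 D, forall k, `|c k| = (k \in S)%:R.
Proof.
case=> c cS bc; suff cC : c \in cycles (D := D) by exists (Cycle cC).
by apply/eqP/ffunP => z; rewrite bc subrr ffunE.
Qed.

Lemma path_chain_arrow a b : path_chain [set arrow_cell a] (a, ~~ b) (a, b).
Proof.
suff p : path_chain [set arrow_cell a] (a, false) (a, true).
  by case: b => //; exact: path_chain_sym.
exists [ffun k => (k == arrow_cell a)%:R] => [k|[a' b']].
  by rewrite ffunE inE; case: (k == _).
rewrite boundaryE !ffunE /= /arrow_cell /= !(inj_eq inr_inj) !xpair_eqE add0r.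
by case: b'; rewrite /= ?andbT ?andbF ?subr0 ?sub0r.
Qed.

Lemma bdry_pair x u v : bdry x = [set u; v] ->
  (x = u /\ succ x = v) \/ (x = v /\ succ x = u).
Proof.
move=> e; have := set21 x (succ x); have := set22 x (succ x); have := succ_neq x.
rewrite -/(bdry x) e !inE => neq /orP[]/eqP ev /orP[]/eqP eu; [|by right|by left|];
  by rewrite ev eu eqxx in neq.
Qed.

Lemma path_chain_edge x u v : bdry x = [set u; v] -> path_chain [set edge_cell x] u v.
Proof.
suff p : path_chain [set edge_cell x] x (succ x).
  by case/bdry_pair => -[<- <-] //; exact: path_chain_sym.
exists [ffun k => (k == edge_cell x)%:R] => [k|z].
  by rewrite ffunE inE; case: (k == _).
rewrite boundaryE !ffunE /= /edge_cell /edge_from /= !(inj_eq inl_inj).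
rewrite oppr0 if_same addr0; congr ((nat_of_bool _)%:R - _).
by apply/eqP/eqP => [<-|->]; rewrite /succ ?permKV ?permK.
Qed.

End PathChains.
Section Obstructions.
Variables D D' : gauss_diagram.

(** The loop follows the arrow to its head and returns to the tail by the edge. *)
Lemma R1_loop (f : arrow D' -> arrow D) a x : R1_shape f a x ->
  exists c : H1 D, forall k, `|c k| = (k \in [set arrow_cell a; edge_cell x])%:R.
Proof.
case=> _ _ /path_chain_edge p; apply: (@path_chain_loop _ _ (tail a)).
by apply: path_chain_cat (path_chain_arrow a true) p; rewrite disjoints1 !inE.
Qed.

Lemma R2_neq (f : arrow D' -> arrow D) a b x y : R2_shape f a b x y -> (a != b) && (x != y).
Proof.
case=> _ _ ab bx bY; apply/andP; split.
  by apply: contraNneq ab => ->.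
apply/eqP => xy; have := set21 (head a) (head b).
by rewrite -bx xy bY !inE !xpair_eqE !andbF.
Qed.

Lemma R2_loop (f : arrow D' -> arrow D) a b x y : R2_shape f a b x y ->
  exists c : H1 D, forall k, `|c k| =
    (k \in [set arrow_cell a; arrow_cell b; edge_cell x; edge_cell y])%:R.
Proof.
move=> sh; have /andP[ab xy] := R2_neq sh.
case: sh => _ _ _ /path_chain_edge px; rewrite setUC => /path_chain_edge py.
(* The loop goes along [a], across [x] from head to head, back along [b], and across [y] from tail
   to tail. *)
apply: (@path_chain_loop _ _ (tail a)); rewrite (setUAC [set arrow_cell a]).
apply: path_chain_cat py; last first.
  apply: path_chain_cat (path_chain_arrow b false); last first.
    by apply: path_chain_cat (path_chain_arrow a true) px; rewrite disjoints1 !inE.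
  by rewrite disjoint_sym disjoints1 !inE /= (inj_eq inr_inj) orbF eq_sym.
by rewrite disjoint_sym disjoints1 !inE /= !(inj_eq inl_inj) orbF eq_sym.
Qed.

Lemma bdry_neq x (a b : arrow D) c d : a != b -> bdry x = [set (a, c); (b, d)] ->
  arrow_of x != arrow_of (succ x).
Proof. by move=> neq /bdry_pair[] [-> ->] //=; rewrite eq_sym. Qed.

Lemma bdry_arrows x (a b : arrow D) : a != b ->
  [set arrow_of y | y in bdry x] = [set a; b] ->
  exists c d, bdry x = [set (a, c); (b, d)].
Proof.
move=> neq e; have := set21 a b; have := set22 a b.
rewrite -e => /imsetP[y yx by_] /imsetP[z zx az].
exists (is_head z), (is_head y); rewrite by_ az -!surjective_pairing.
have yz : z != y by apply: contraNneq neq => zy; rewrite by_ az zy.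
rewrite /bdry in yx zx *; case/set2P: yx yz => ->; case/set2P: zx => ->; rewrite ?eqxx //.
by move=> _; rewrite setUC.
Qed.

End Obstructions.

(** * The exchange of R3 *)

Section Exchange.
Variables (pi : zmodType) (D : gauss_diagram) (F : end_of D -> pi) (x : 'I_3 -> end_of D).
Hypothesis bdry_dis : forall i j, i != j -> [disjoint bdry (x i) & bdry (x j)].

Lemma bdry_inj i j y : y \in bdry (x i) -> y \in bdry (x j) -> i = j.
Proof.
by move=> yi yj; apply/eqP/negPn/negP => /bdry_dis /disjointFr -/(_ _ yi); rewrite yj.
Qed.

Lemma tperm_bdry (z y : end_of D) : y \notin bdry z -> tperm z (succ z) y = y.
Proof. by rewrite !inE negb_or => /andP[zy szy]; rewrite tpermD // eq_sym. Qed.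

Lemma mem_tperm_bdry (z y : end_of D) : y \in bdry z -> tperm z (succ z) y \in bdry z.
Proof. by case/set2P => ->; rewrite ?tpermL ?tpermR !inE eqxx ?orbT. Qed.

Lemma exchange_out y : (forall i, y \notin bdry (x i)) -> exchange x y = y.
Proof. by move=> yN; rewrite /exchange !big_ord_recl big_ord0 mulg1 !permM !tperm_bdry. Qed.

(** The three transpositions have disjoint supports, so only the one at the edge containing [y]
    moves it. *)
Lemma exchange_in i y : y \in bdry (x i) -> exchange x y = tperm (x i) (succ (x i)) y.
Proof.
move=> yi; have out j z : i != j -> z \in bdry (x i) -> tperm (x j) (succ (x j)) z = z.
  by move=> ij zi; rewrite tperm_bdry //; apply: contraNN ij => zj; rewrite (bdry_inj zi zj).
have ti := mem_tperm_bdry yi.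
rewrite /exchange !big_ord_recl big_ord0 mulg1 !permM.
set i0 : 'I_3 := ord0; set i2 := lift _ (lift _ _); set i1 := lift _ _.
have : i \in [:: i0; i1; i2] by rewrite !inE; case: i {yi out ti} => [[|[|[|]]]].
rewrite !inE => /or3P[]/eqP e; rewrite e in out ti yi *.
- by rewrite (out i1 _ isT ti) (out i2 _ isT ti).
- by rewrite (out i0 _ isT yi) (out i2 _ isT ti).
- by rewrite (out i0 _ isT yi) (out i1 _ isT yi).
Qed.

Lemma exchangeK : involutive (exchange x).
Proof.
move=> y; have [i yi|yN] := pickP (fun i => y \in bdry (x i)).
  by rewrite (exchange_in yi) (exchange_in (mem_tperm_bdry yi)) tpermK.
by rewrite !exchange_out // => i; rewrite yN.
Qed.

Hypothesis F0 : forall i, F (x i) = 0.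

(** The starting point slides across an edge of value zero that does not contain [v]. *)
Lemma arc_sum_exchangel i u v : u \in bdry (x i) -> v \notin bdry (x i) ->
  arc_sum F (exchange x u) v = arc_sum F u v.
Proof.
move=> ui; rewrite (exchange_in ui) !inE negb_or => /andP[vx vsx].
have e : arc_sum F (succ (x i)) v = arc_sum F (x i) v.
  by rewrite [RHS]arc_sum_cons ?F0 ?add0r // eq_sym.
by case/set2P: ui => ->; rewrite ?tpermL ?tpermR e.
Qed.

Lemma exchange_bdry i u : (exchange x u \in bdry (x i)) = (u \in bdry (x i)).
Proof.
have mono y : y \in bdry (x i) -> exchange x y \in bdry (x i).
  by move=> yi; rewrite (exchange_in yi) mem_tperm_bdry.
by apply/idP/idP => [/mono|/mono //]; rewrite exchangeK.
Qed.

(** Passing to the complementary arc turns the end point into a starting point, and the total over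
    the circle cancels. *)
Lemma arc_sum_exchanger i u v : v \in bdry (x i) -> u \notin bdry (x i) ->
  arc_sum F u (exchange x v) = arc_sum F u v.
Proof.
move=> vi ui; have neq y : y \in bdry (x i) -> u != y by apply: contraTneq => <-.
have := arc_sumC F (neq _ vi); rewrite -(arc_sumC F (neq (exchange x v) _)) ?exchange_bdry //.
by rewrite (arc_sum_exchangel vi ui) => /addIr ->.
Qed.

(* The hypothesis excludes pairs of ends that are interchanged, for which the
   arc would be replaced by its complement. *)
Lemma arc_sum_exchange u v : (forall i, u \in bdry (x i) -> v \notin bdry (x i)) ->
  arc_sum F (exchange x u) (exchange x v) = arc_sum F u v.
Proof.
move=> uv; have -> : arc_sum F (exchange x u) (exchange x v) = arc_sum F u (exchange x v).
  have [i ui|uN] := pickP (fun i => u \in bdry (x i)).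
    by rewrite (arc_sum_exchangel ui) // exchange_bdry uv.
  by rewrite (exchange_out (y := u)) // => i; rewrite uN.
have [i vi|vN] := pickP (fun i => v \in bdry (x i)).
  by rewrite (arc_sum_exchanger vi) //; apply: contraTN vi; exact: uv.
by rewrite (exchange_out (y := v)) // => i; rewrite vN.
Qed.

End Exchange.

(** * The hexagon formed by the arrows and edges of R3 *)

Lemma uniq3 (T : eqType) (p q r : T) : uniq [:: p; q; r] = [&& p != q, p != r & q != r].
Proof. by rewrite /= !inE negb_or -!andbA andbT. Qed.

Section Hexagon.
Variables (D D' : gauss_diagram) (f : arrow D -> arrow D') (a : 'I_3 -> arrow D).
Variable x : 'I_3 -> end_of D.
Hypothesis sh : R3_shape f a x.

Let i0 : 'I_3 := inord 0.
Let i1 : 'I_3 := inord 1.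
Let i2 : 'I_3 := inord 2.

(** [k0], [k1], [k2] index the edges opposite to the arrows [a i0], [a i1], [a i2]. Each arrow
    bounds the other two edges, which are disjoint, so it meets them at opposite ends: arrows and
    edges alternate along a hexagon. *)
Lemma R3_hexagon : exists (k0 k1 k2 : 'I_3) (c0 c1 c2 : bool),
  [/\ uniq [:: k0; k1; k2] /\ (forall i, i \in [:: k0; k1; k2]),
      uniq [:: a i0; a i1; a i2] /\ (forall i, i \in [:: i0; i1; i2]),
      bdry (x k2) = [set (a i0, c0); (a i1, c1)],
      bdry (x k0) = [set (a i1, ~~ c1); (a i2, c2)]
    & bdry (x k1) = [set (a i2, ~~ c2); (a i0, ~~ c0)]].
Proof.
case: sh => -[a_inj a_ex x_dis] _ _ _.
have cover (s : seq 'I_3) : uniq s -> size s = 3 -> forall i, i \in s.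
  move=> us ss i; have := @uniq_min_size _ s (enum 'I_3) us.
  by rewrite size_enum_ord ss => /(_ (fun j _ => mem_enum _ j) isT)[_ ->]; rewrite mem_enum.
have ui : uniq [:: i0; i1; i2] by rewrite /= !inE -!val_eqE /= !inordK.
have ua : uniq [:: a i0; a i1; a i2] by rewrite (map_inj_uniq a_inj [:: i0; i1; i2]).
have /and3P[a01 a02 a12] := etrans (esym (uniq3 _ _ _)) ua.
have getx p q : a p != a q -> exists k c d, bdry (x k) = [set (a p, c); (a q, d)].
  move=> pq; have [k [bk _]] := a_ex p q (contra_neq (@congr1 _ _ a p q) pq).
  by have [c [d e]] := bdry_arrows pq bk; exists k, c, d.
have [k2 [c0 [c1 b2]]] := getx _ _ a01.
have [k0 [d1 [c2 b0]]] := getx _ _ a12.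
have [k1 [d2 [d0 b1]]] : exists k c d, bdry (x k) = [set (a i2, c); (a i0, d)].
  by apply: getx; rewrite eq_sym.
have k20 : k2 != k0.
  apply/eqP => e; have := set21 (a i0, c0) (a i1, c1).
  by rewrite -b2 e b0 !inE !xpair_eqE (negPf a01) (negPf a02).
have k21 : k2 != k1.
  apply/eqP => e; have := set22 (a i0, c0) (a i1, c1).
  by rewrite -b2 e b1 !inE !xpair_eqE (negPf a12) (eq_sym (a i1) (a i0)) (negPf a01).
have k01 : k0 != k1.
  apply/eqP => e; have := set21 (a i1, d1) (a i2, c2).
  by rewrite -b0 e b1 !inE !xpair_eqE (negPf a12) (eq_sym (a i1) (a i0)) (negPf a01).
have neg k k' b c d : k != k' -> (b, c) \in bdry (x k) -> (b, d) \in bdry (x k') -> d = ~~ c.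
  move=> kk bk bk'; have [dc|] := eqVneq d c; last by case: d c {bk bk'} => [] [].
  by have := disjointFr (x_dis _ _ kk) bk; rewrite -dc bk'.
have d1E : d1 = ~~ c1.
  by apply: (neg _ _ (a i1) _ _ k20); rewrite ?b2 ?b0 !inE eqxx ?orbT.
have d2E : d2 = ~~ c2.
  by apply: (neg _ _ (a i2) _ _ k01); rewrite ?b0 ?b1 !inE eqxx ?orbT.
have d0E : d0 = ~~ c0.
  by apply: (neg _ _ (a i0) _ _ k21); rewrite ?b2 ?b1 !inE eqxx ?orbT.
have uk : uniq [:: k0; k1; k2] by rewrite uniq3 k01 (eq_sym k0) k20 (eq_sym k1) k21.
exists k0, k1, k2, c0, c1, c2; split; rewrite -?d1E -?d2E -?d0E //.
  by split=> //; exact: cover.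
split=> //. by apply: cover.
Qed.

Lemma imset_I3 (T : finType) (g : 'I_3 -> T) p q r : (forall i, i \in [:: p; q; r]) ->
  [set g i | i : 'I_3] = [set g p; g q; g r].
Proof.
move=> all_i; apply/setP => t; apply/imsetP/idP => [[i _ ->]|].
  by have := all_i i; rewrite !inE -orbA => /or3P[]/eqP ->; rewrite eqxx ?orbT.
by rewrite !inE -orbA => /or3P[]/eqP ->; [exists p|exists q|exists r].
Qed.

Lemma R3_loop : exists c : H1 D, forall k, `|c k| =
  (k \in [set arrow_cell (a i) | i : 'I_3] :|: [set edge_cell (x i) | i : 'I_3])%:R.
Proof.
have [k0 [k1 [k2 [c0 [c1 [c2 [[uk ck] [ua ca] b2 b0 b1]]]]]]] := R3_hexagon.
have x_inj : injective x.
  move=> i j e; case: sh => -[_ _ x_dis] _ _ _; apply: (bdry_inj x_dis (y := x i)).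
    exact: set21.
  by rewrite e; exact: set21.
have : uniq (map x [:: k0; k1; k2]) by rewrite map_inj_uniq.
rewrite (imset_I3 _ ca) (imset_I3 _ ck) uniq3.
have /and3P[a01 a02 a12] := etrans (esym (uniq3 _ _ _)) ua.
case/and3P => x01 x02 x12.
(* The loop runs along [a i0], then [x k2], [a i1], [x k0], [a i2] and [x k1]. *)
apply: (@path_chain_loop _ _ (a i0, ~~ c0)).
have -> : [set arrow_cell (a i0); arrow_cell (a i1); arrow_cell (a i2)]
      :|: [set edge_cell (x k0); edge_cell (x k1); edge_cell (x k2)]
    = [set arrow_cell (a i0)] :|: [set edge_cell (x k2)] :|: [set arrow_cell (a i1)]
      :|: [set edge_cell (x k0)] :|: [set arrow_cell (a i2)] :|: [set edge_cell (x k1)].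
  by apply/setP => k; rewrite !inE; do ! case: eqP => _.
have flip (b : arrow D) c : path_chain [set arrow_cell b] (b, c) (b, ~~ c).
  by have := path_chain_arrow b (~~ c); rewrite negbK.
have cell_ee z z' : (edge_cell z == edge_cell z' :> cell D) = (z == z').
  by rewrite /edge_cell /edge_from !(inj_eq inl_inj).
have cell_aa b b' : (arrow_cell b == arrow_cell b' :> cell D) = (b == b').
  by rewrite (inj_eq inr_inj).
have disE (S : {set cell D}) k : k \notin S -> [disjoint S & [set k]].
  by rewrite disjoint_sym disjoints1.
apply: path_chain_cat (path_chain_edge b1); last first.
  apply: path_chain_cat (flip _ _); last first.
    apply: path_chain_cat (path_chain_edge b0); last first.
      apply: path_chain_cat (flip _ _); last first.
        apply: path_chain_cat (path_chain_edge b2); last exact: path_chain_arrow.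
        by apply: disE; rewrite !inE.
      by apply: disE; rewrite !inE cell_aa orbF eq_sym.
    by apply: disE; rewrite !inE cell_ee /= orbF.
  by apply: disE; rewrite !inE !cell_aa /= !orbF negb_or eq_sym a02 eq_sym.
by apply: disE; rewrite !inE !cell_ee /= !orbF negb_or x12 eq_sym.
Qed.

Lemma R3_bdry_neq i : arrow_of (x i) != arrow_of (succ (x i)).
Proof.
have [k0 [k1 [k2 [c0 [c1 [c2 [[_ ck] [ua _] b2 b0 b1]]]]]]] := R3_hexagon.
have /and3P[a01 a02 a12] := etrans (esym (uniq3 _ _ _)) ua.
have := ck i; rewrite !inE => /or3P[]/eqP ->.
- exact: bdry_neq a12 b0.
- by rewrite eq_sym in a02; exact: bdry_neq a02 b1.
- exact: bdry_neq a01 b2.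
Qed.

End Hexagon.

Lemma R3_same_decorations (pi : zmodType) (D D' : marked_diagram pi)
    (f : arrow D -> arrow D') a x :
  R3_shape f a x -> (forall i, mark (edge_from (x i)) = 0) ->
  (forall y, mark (edge_from (map_end f (exchange x y))) = mark (edge_from y)) ->
  same_decorations (A := ab D) (A' := ab D') f.
Proof.
move=> sh x0 f_mark; have neq := R3_bdry_neq sh.
case: sh => -[_ _ x_dis] _ _ [f_bij _ f_succ].
(* [phi] follows the points of the circle rather than the arrow ends, so it commutes with [succ] and
   preserves marks. *)
pose phi y := map_end f (exchange x y).
have phi_inj : injective phi.
  by move=> y z /(map_end_inj (bij_inj f_bij)); exact: perm_inj.
have phi_between y z : phi z \notin behead (arc (phi y) (phi (succ y))).
  by rewrite /phi -f_succ arc_succ.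
have phi_sum y : edge_mark y = arc_sum (@edge_mark _ D') (phi y) (phi (succ y)).
  by rewrite /phi -f_succ arc_sum_succ; symmetry; exact: f_mark.
apply: same_decorations_ab => [c|].
  have -> : head (f c) = phi (exchange x (head c)) by rewrite /phi exchangeK.
  have -> : tail (f c) = phi (exchange x (tail c)) by rewrite /phi exchangeK.
  rewrite -(arc_sum_map phi_inj phi_between phi_sum).
  (* No exchanged edge is bounded by both ends of a single arrow. *)
  apply: arc_sum_exchange => // i hi; apply: contraNN (neq i).
  case/set2P: hi => e1 /set2P[] e2.
  - by have := etrans e1 (esym e2).
  - by rewrite -e2 -e1.
  - by rewrite -e1 -e2.
  - by have := etrans e1 (esym e2).
have [y _|no_end] := pickP (predT : pred (end_of D)).
  rewrite (sum_edges y) (sum_edges (phi y)); symmetry.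
  exact: (sum_map phi_inj phi_between phi_sum y).
by have := no_end (x ord0).
Qed.
(** * Correspondence of the moves *)

Section Steps.
Variable pi : zmodType.
Implicit Types (D : marked_diagram pi) (A : abelian_diagram pi).

Lemma iso_merged D D' (f : arrow D -> arrow D') : isomorphism f ->
  (forall x, mark (edge_from (map_end f x)) = mark (edge_from x)) ->
  (forall u v, mark (inr u : edge D') = mark (inr v : edge D)) ->
  merged_marking (D := D') (D' := D) f.
Proof.
case=> f_bij _ f_succ f_mark f_circle; split=> [x|u].
  by rewrite f_succ arc_succ big_seq1 f_mark.
have no_arrow : #|arrow D'| == 0%N by rewrite -(bij_eq_card f_bij) (valP u).
by rewrite (sum_edges0 (exist _ tt no_arrow)) (f_circle _ u).
Qed.

Lemma virtual_step_ab D D' : virtual_step D D' -> ab D ~a ab D'.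
Proof.
case=> [[f [iso_f f_mark f_circle]]|[[f [a [x [sh merged x0]]]]
  |[[f [a [b [x [y [sh merged x0 y0]]]]]]|[[f [a [x [sh x0 f_mark]]]]|[a [g ->]]]]]].
- apply: rst_step; left; exists f; split=> //.
  apply: merged_same_decorations (iso_merged iso_f f_mark f_circle).
  exact: isomorphism_subdiagram.
- apply: rst_step; right; left; exists f, a, x; split=> //.
    by case: sh => sub _ _; exact: merged_same_decorations.
  have [c cS] := R1_loop sh; apply: (obstruction_vanishes_ab cS) => [z|u]; last by rewrite !inE.
  by rewrite !inE => /eqP[->].
- apply: rst_step; do 2! right; left; exists f, a, b, x, y; split=> //.
    by case: sh => sub _ _ _ _; exact: merged_same_decorations.
  have [c cS] := R2_loop sh; apply: (obstruction_vanishes_ab cS) => [z|u]; last by rewrite !inE.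
  by rewrite !inE /= => /orP[]/eqP[->].
- apply: rst_step; do 3! right; exists f, a, x; split=> //.
    exact: R3_same_decorations sh x0 f_mark.
  have [c cS] := R3_loop sh; apply: (obstruction_vanishes_ab cS) => [z|u].
    by rewrite inE => /orP[]/imsetP[i _ []] // ->.
  by rewrite inE; apply/orP => -[]/imsetP[].
(* A [w0]-move adds a potential supported on [a], hence yields another lift of [ab D]. *)
- have L := @is_lift_add_potential _ (ab D) _ (fun b : arrow D => g *+ (b == a)) (ab_is_lift D).
  exact: (lift_ab L).
Qed.

(** Since [b] bounds [x] on one side only, a [w0]-move at [b] changes the mark of [x] by plus or
    minus [g], and affects only edges bounded by [b]. *)
Lemma clear_edge A m (x : end_of A) b : is_lift m ->
  arrow_of x != arrow_of (succ x) -> (b == arrow_of x) || (b == arrow_of (succ x)) ->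
  exists m', [/\ is_lift m', m' (edge_from x) = 0
    & forall y, b != arrow_of y -> b != arrow_of (succ y) -> m' (edge_from y) = m (edge_from y)].
Proof.
move=> m_lift neq bx; pose g := if b == arrow_of x then m (edge_from x) else - m (edge_from x).
exists (add_potential (fun c => g *+ (b == c)) m); split; first exact: is_lift_add_potential.
  rewrite /= /g; case: eqP bx neq => [<- _ /negPf->|_ /= -> _].
    by rewrite addr0 subrr.
  by rewrite subr0 subrr.
by move=> y /negPf by1 /negPf by2 /=; rewrite by1 by2 addr0 subr0.
Qed.

Definition merge_marking D (D' : gauss_diagram) (f : arrow D' -> arrow D) (e : edge D') : pi :=
  match e with
  | inl x => arc_sum (@edge_mark _ D) (map_end f x) (map_end f (succ x))
  | inr _ => \sum_(d : edge D) mark d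
  end.

Lemma merge_lift A A' (f : arrow A' -> arrow A) m : subdiagram f -> same_decorations f ->
  is_lift m -> is_lift (A := A') (merge_marking (D := Marked m) f).
Proof.
move=> sub f_dec m_lift; apply: (lift_pull m_lift f_dec).
exact: (@merged_same_decorations _ (Marked m) (Marked (merge_marking _)) f sub).
Qed.

Lemma abelian_step_lift A A' : abelian_step A A' ->
  exists m m', [/\ is_lift (A := A) m, is_lift (A := A') m' & Marked m ~v Marked m'].
Proof.
have [m m_lift] := lift_exists A.
case=> [[f [iso_f f_dec]]|[[f [a [x [sh f_dec obs]]]]|[[f [a [b [x [y [sh f_dec obs]]]]]]
  |[f [a [x [sh f_dec obs]]]]]]].
(* For an isomorphism, a lift of [A'] is chosen first and pulled back along [f]. *)
- have [m' m'_lift] := lift_exists A'.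
  have sub := isomorphism_subdiagram iso_f.
  exists (merge_marking (D := Marked m') f), m'; split=> //; first exact: merge_lift.
  apply: rst_step; left; exists f; split=> // [x|u v].
    by case: iso_f => _ _ f_succ; rewrite /= f_succ arc_sum_succ.
  by rewrite /= (sum_edges0 u).
(* The loop of R1 has a single edge, so its mark vanishes in any lift. *)
- exists m, (merge_marking (D := Marked m) f).
  case: (sh) => sub _ _; split=> //; first exact: merge_lift.
  apply: rst_step; right; left; exists f, a, x; split=> //=.
  apply: (obstruction_mark m_lift obs); first by rewrite !inE eqxx orbT.
  by move=> e; rewrite !inE /= => /negPf ex /eqP[]; move/eqP: ex.
- have /andP[ab xy] := R2_neq sh; case: (sh) => sub _ _ bx bY.
  (* A [w0]-move at [a] clears [x]; the obstruction then clears [y]. *)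
  have [||m1 [m1_lift m1x _]] := @clear_edge _ _ x a m_lift.
  + by case/bdry_pair: bx => -[-> ->] //=; rewrite eq_sym.
  + by case/bdry_pair: bx => -[-> ->] /=; rewrite eqxx ?orbT.
  exists m1, (merge_marking (D := Marked m1) f); split=> //; first exact: merge_lift.
  apply: rst_step; do 2! right; left; exists f, a, b, x, y; split=> //=.
  apply: (obstruction_mark m1_lift obs); first by rewrite !inE eqxx orbT.
  move=> e ey; rewrite !inE /= => /orP[]/eqP[] eE; rewrite eE //.
  by rewrite eE eqxx in ey.
- have [k0 [k1 [k2 [c0 [c1 [c2 [[uk ck] [ua ca] b2 b0 b1]]]]]]] := R3_hexagon sh.
  have /and3P[a01 a02 a12] := etrans (esym (uniq3 _ _ _)) ua.
  have [||m1 [m1_lift m1x _]] := @clear_edge _ _ (x k2) (a (inord 1)) m_lift.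
  + exact: R3_bdry_neq sh _.
  + by case/bdry_pair: b2 => -[-> ->] /=; rewrite eqxx ?orbT.
  (* The arrow [a (inord 2)] does not bound [x k2], which therefore stays cleared; [x k1] is left to
     the obstruction. *)
  have [||m2 [m2_lift m2x m2_out]] := @clear_edge _ _ (x k0) (a (inord 2)) m1_lift.
  + exact: R3_bdry_neq sh _.
  + by case/bdry_pair: b0 => -[-> ->] /=; rewrite eqxx ?orbT.
  have m2x' : m2 (edge_from (x k2)) = 0.
    by rewrite m2_out // eq_sym; case/bdry_pair: b2 => -[e1 e2]; rewrite ?e2 ?e1.
  have m2x1 : m2 (edge_from (x k1)) = 0.
    apply: (obstruction_mark m2_lift obs); first by apply/setUP; right; exact: imset_f.
    move=> e ek; rewrite inE => /orP[]/imsetP[i _ []] // eE; move: ek; rewrite eE.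
    by have := ck i; rewrite !inE => /or3P[]/eqP -> //; rewrite eqxx.
  have m2_0 i : m2 (edge_from (x i)) = 0.
    by have := ck i; rewrite !inE => /or3P[]/eqP ->.
  case: (sh) => -[_ _ x_dis] _ _ [f_bij _ _]; have [g fK gK] := f_bij.
  (* Marks stay in place while the ends move, and [exchange x] is its own inverse. The value 0 is a
     dummy, as [A'] has arrows. *)
  pose m' (e : edge A') : pi := match e with
    | inl y => m2 (edge_from (exchange x (map_end g y)))
    | inr _ => 0
    end.
  have f_mark y : m' (edge_from (map_end f (exchange x y))) = m2 (edge_from y).
    rewrite /m' /=; congr (m2 (edge_from _)); rewrite -[RHS](exchangeK x_dis).
    by congr (exchange x _); rewrite /map_end /= fK -surjective_pairing.
  exists m2, m'; split=> //.
    apply: (lift_push f_bij m2_lift f_dec).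
    exact: (R3_same_decorations (D := Marked m2) (D' := Marked m') sh m2_0 f_mark).
  by apply: rst_step; do 3! right; left; exists f, a, x; split.
Qed.

(** Quantifying over all lifts lets the induction chain steps: [lift_unique] passes between lifts of
    the same diagram, and transitivity picks one of the middle diagram. *)
Lemma abelian_equiv_lift A A' : A ~a A' ->
  forall m m', is_lift (A := A) m -> is_lift (A := A') m' -> Marked m ~v Marked m'.
Proof.
elim=> {A A'} [A A' /abelian_step_lift[m1 [m1' [m1_lift m1'_lift mm]]]|A|A A' _ IH
  |A B C _ IHA _ IHB] m m' m_lift m'_lift.
- apply: rst_trans (lift_unique m_lift m1_lift) _.
  exact: rst_trans mm (lift_unique m1'_lift m'_lift).
- exact: lift_unique.
- by apply: rst_sym; exact: IH.
- have [n n_lift] := lift_exists B.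
  by apply: rst_trans (IHA _ _ m_lift n_lift) (IHB _ _ n_lift m'_lift).
Qed.

Lemma virtual_equiv_ab D D' : D ~v D' <-> ab D ~a ab D'.
Proof.
split=> [|abDD']; last first.
  case: D D' abDD' => [D m] [D' m'] abDD'.
  exact: (@abelian_equiv_lift _ (ab _) abDD' m m' (ab_is_lift (Marked m)) (ab_is_lift (Marked m'))).
elim=> {D D'} [D D'|D|D D' _|D D' D'' _ IH _ IH'].
- exact: virtual_step_ab.
- exact: rst_refl.
- exact: rst_sym.
- exact: rst_trans IH IH'.
Qed.

Lemma ab_surjective A : exists D, A ~a ab D.
Proof. by have [m /lift_ab] := lift_exists A; exists (Marked m). Qed.

End Steps.

(** * Bijections between sets of classes *)

Section Classes.
Variables (T U : Type) (stepT : T -> T -> Prop) (stepU : U -> U -> Prop) (h : T -> U).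
Local Notation eqT := (clos_refl_sym_trans T stepT).
Local Notation eqU := (clos_refl_sym_trans U stepU).
Hypothesis h_equiv : forall x y, eqT x y <-> eqU (h x) (h y).
Hypothesis h_surj : forall u, exists x, eqU u (h x).

Lemma class_eqP (V : Type) (step : V -> V -> Prop) (C C' : classes step) :
  (forall x, sval C x <-> sval C' x) -> C = C'.
Proof.
case: C C' => [P exP] [Q exQ] /= PQ; have e : P = Q.
  by apply: functional_extensionality => x; apply: propositional_extensionality.
by move: exP exQ; rewrite e => exP exQ; congr exist; exact: proof_irrelevance.
Qed.

(** The image of a class under [h] is saturated by [eqU], since [h] need not reach every member of
    the target class. *)
Lemma push_class (C : classes stepT) :
  exists u, (fun u' => exists x, sval C x /\ eqU (h x) u') = eqU u.
Proof.
case: C => P [x /= ->]; exists (h x); apply: functional_extensionality => u.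
apply: propositional_extensionality; split=> [[y [/h_equiv xy yu]]|xu].
  exact: rst_trans xy yu.
by exists x; split=> //; exact: rst_refl.
Qed.

(** Surjectivity up to [eqU] makes the preimage nonempty, and reflection of the equivalence by [h]
    makes it a single class. *)
Lemma pull_class (C : classes stepU) : exists x, (fun x' => sval C (h x')) = eqT x.
Proof.
case: C => P [u /= ->]; have [x ux] := h_surj u; exists x; apply: functional_extensionality => y.
apply: propositional_extensionality; split=> [/= uy|/h_equiv xy].
  by apply/h_equiv; apply: rst_trans uy; exact: rst_sym.
exact: rst_trans ux xy.
Qed.

Lemma classes_bijection : exists h_star : classes stepT -> classes stepU,
  (forall x, h_star (class_of stepT x) = class_of stepU (h x)) /\ bijective h_star.
Proof.
exists (fun C => exist (fun P => exists u, P = eqU u) _ (push_class C)); split=> [x|].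
  apply: class_eqP => u /=; split=> [[y [/h_equiv xy yu]]|xu]; first exact: rst_trans xy yu.
  by exists x; split=> //; exact: rst_refl.
exists (fun C => exist (fun P => exists x, P = eqT x) _ (pull_class C)) => -[P [z zE]];
  apply: class_eqP => t /=; rewrite zE /=.
  split=> [[y [zy /h_equiv yt]]|zt]; first exact: rst_trans zy yt.
  by exists t; split=> //; exact: rst_refl.
split=> [[y [zy yt]]|zt]; first exact: rst_trans zy yt.
by have [y ty] := h_surj t; exists y; split; [exact: rst_trans zt ty|exact: rst_sym].
Qed.

End Classes.

Theorem theorem3p12 (pi : zmodType) :
  exists ab_star : virtual_knot_type pi -> abelian_class pi,
    (forall D : marked_diagram pi,
       ab_star (class_of (@virtual_step pi) D) = class_of (@abelian_step pi) (ab D))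
    /\ bijective ab_star.
Proof.
exact: (classes_bijection (@virtual_equiv_ab pi) (@ab_surjective pi)).
Qed.
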